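(* Let $G$ be a finite group. The following conditions are equivalent: (1) The order of $G$ is odd. (2) The map $\wedge$, $\pi\mapsto\wedge\pi$, defined on finite dimensional complex representations of $G$, extends to virtual representations as a morphism from the additive group $R(G)_{\mathbb Z}$ to the multiplicative monoid $R(G)_{\mathbb C}$; that is, there exists a map $\wedge: R(G)_{\mathbb Z}\to R(G)_{\mathbb C}$ with $\wedge(0)=1$ and $\wedge(x+y)=\wedge(x)\wedge(y)$ for all $x,y\in R(G)_{\mathbb Z}$, whose value on the class of every finite dimensional representation $\pi$ is the class of $\wedge\pi$.
   Context: For a finite dimensional complex representation $\pi$ of $G$ on $E$, $\wedge\pi$ denotes the representation of $G$ on $\bigoplus_{n\ge 0}\wedge^n E$, the sum of all exterior powers of $E$; it satisfies $\wedge(\pi_1\oplus\pi_2)=\wedge(\pi_1)\otimes\wedge(\pi_2)$. $R(G)_{\mathbb Z}$ is the representation ring of $G$ (virtual finite dimensional complex representations, obtained by symmetrization of the additive monoid of isomorphism classes of representations). $R(G)_{\mathbb C}=R(G)_{\mathbb Z}\otimes_{\mathbb Z}\mathbb C$ is the complexified representation ring, identified via characters with the ring $C(G)$ of complex valued class functions on $G$ under pointwise operations; it is regarded as a multiplicative monoid under its product. *)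

(* Defs.v *)
From HB Require Import structures.
From mathcomp Require Import all_boot all_order all_algebra all_fingroup.
From mathcomp Require Import generic_quotient mxrepresentation character.
From mathcomp Require Import boolp reals complex.

Set Implicit Arguments.
Unset Strict Implicit.
Unset Printing Implicit Defensive.

Import GroupScope GRing.Theory.
Local Open Scope ring_scope.
Local Open Scope quotient_scope.

(* Symmetrization of a commutative monoid: (a, b) stands for a - b.  The extra
   summand e makes the relation transitive when M is not cancellative. *)
Section Symmetrization.

Variable M : nmodType.

Definition sym_rel (u v : {classic (M * M)}) : bool :=
  `[< exists e : M, u.1 + v.2 + e = v.1 + u.2 + e >].

Lemma sym_rel_equiv : equiv_class_of sym_rel.
Proof.
split=> [u|u v|v u w].
- by apply/asboolP; exists 0.
- by apply/asboolP/asboolP=> -[e ee]; exists e.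
move=> /asboolP[e ee] /asboolP[f ff]; apply/asboolP.
exists (v.1 + v.2 + e + f).
transitivity ((u.1 + v.2 + e) + (v.1 + w.2 + f)).
  by rewrite !addrA [LHS](ACl (1*4*5*3*2*6)).
by rewrite ee ff !addrA [LHS](ACl (4*2*1*5*3*6)).
Qed.

Canonical sym_equiv := EquivRelPack sym_rel_equiv.

Definition symmetrization : Type := {eq_quot sym_equiv}.
HB.instance Definition _ := Choice.on symmetrization.
HB.instance Definition _ := Quotient.on symmetrization.

Definition sym_pair (a b : M) : symmetrization :=
  \pi_symmetrization ((a, b) : {classic (M * M)}).

Lemma sym_pairE a b c d :
  (sym_pair a b = sym_pair c d) <-> exists e, a + d + e = c + b + e.
Proof.
split=> [/(@eqmodP _ sym_equiv)/asboolP //|ee].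
by apply/(@eqmodP _ sym_equiv)/asboolP.
Qed.

Lemma sym_pair_repr u : sym_pair (repr u).1 (repr u).2 = u.
Proof. by rewrite /sym_pair -surjective_pairing reprK. Qed.

Definition sym_add (u v : symmetrization) :=
  sym_pair ((repr u).1 + (repr v).1) ((repr u).2 + (repr v).2).
Definition sym_opp (u : symmetrization) := sym_pair (repr u).2 (repr u).1.

Lemma sym_addE a b c d :
  sym_add (sym_pair a b) (sym_pair c d) = sym_pair (a + c) (b + d).
Proof.
have /sym_pairE[e ee] := sym_pair_repr (sym_pair a b).
have /sym_pairE[f ff] := sym_pair_repr (sym_pair c d).
rewrite /sym_add; set u := repr _ in ee *; set v := repr _ in ff *.
apply/sym_pairE; exists (e + f).
transitivity ((u.1 + b + e) + (v.1 + d + f)).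
  by rewrite !addrA [LHS](ACl (1*3*5*2*4*6)).
by rewrite ee ff !addrA [LHS](ACl (1*4*2*5*3*6)).
Qed.

Lemma sym_oppE a b : sym_opp (sym_pair a b) = sym_pair b a.
Proof.
have /sym_pairE[e ee] := sym_pair_repr (sym_pair a b).
by apply/sym_pairE; exists e; rewrite [_ + a]addrC -ee [X in X + e]addrC.
Qed.

Fact sym_addA : associative sym_add.
Proof.
move=> u v w; rewrite -(sym_pair_repr u) -(sym_pair_repr v) -(sym_pair_repr w).
by rewrite !sym_addE !addrA.
Qed.

Fact sym_addC : commutative sym_add.
Proof. by move=> u v; rewrite /sym_add addrC [X in sym_pair _ X]addrC. Qed.

Fact sym_add0 : left_id (sym_pair 0 0) sym_add.
Proof. by move=> u; rewrite -(sym_pair_repr u) sym_addE !add0r. Qed.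

Fact sym_addN : left_inverse (sym_pair 0 0) sym_opp sym_add.
Proof.
move=> u; rewrite -(sym_pair_repr u) sym_oppE sym_addE.
by apply/sym_pairE; exists 0; rewrite !addr0 add0r addrC.
Qed.

HB.instance Definition _ :=
  GRing.isZmodule.Build symmetrization sym_addA sym_addC sym_add0 sym_addN.

End Symmetrization.

Section VirtualRepresentations.

Variables (F : fieldType) (gT : finGroupType) (G : {group gT}).
Local Notation grepr := (representation F G).

Definition rsim_rel (r s : {classic grepr}) : bool := `[< mx_rsim r s >].

Lemma rsim_rel_equiv : equiv_class_of rsim_rel.
Proof.
split=> [r|r s|s r t].
- by apply/asboolP; apply: mx_rsim_refl.
- by apply/asboolP/asboolP; apply: mx_rsim_sym.
by move=> /asboolP rs /asboolP st; apply/asboolP; apply: mx_rsim_trans rs st.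
Qed.

Canonical rsim_equiv := EquivRelPack rsim_rel_equiv.

Definition iso_class : Type := {eq_quot rsim_equiv}.
HB.instance Definition _ := Choice.on iso_class.
HB.instance Definition _ := Quotient.on iso_class.

Definition iso_class_of (r : grepr) : iso_class :=
  \pi_iso_class (r : {classic grepr}).

Lemma iso_class_ofE r s : (iso_class_of r = iso_class_of s) <-> mx_rsim r s.
Proof.
split=> [/(@eqmodP _ rsim_equiv)/asboolP //|rs].
by apply/(@eqmodP _ rsim_equiv)/asboolP.
Qed.

Lemma iso_class_repr c : iso_class_of (repr c) = c.
Proof. exact: reprK. Qed.

Lemma dadd_rsim (r r' s s' : grepr) :
  mx_rsim r r' -> mx_rsim s s' ->
  mx_rsim (dadd_grepr r s) (dadd_grepr r' s').
Proof.
case=> A eA fA hA [B eB fB hB]; exists (block_mx A 0 0 B) => /=.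
- by rewrite eA eB.
- have [A' AA'] := row_freeP fA; have [B' BB'] := row_freeP fB.
  apply/row_freeP; exists (block_mx A' 0 0 B').
  by rewrite mulmx_block !(mul0mx, mulmx0, addr0, add0r) AA' BB'
             -scalar_mx_block.
move=> x Gx; rewrite !mulmx_block !(mul0mx, mulmx0, addr0, add0r).
by rewrite hA ?hB.
Qed.

Lemma dadd_rsimC (r s : grepr) : mx_rsim (dadd_grepr r s) (dadd_grepr s r).
Proof.
exists (block_mx 0 1%:M 1%:M 0) => [/=||x Gx /=]; first by rewrite addnC.
  apply/row_freeP; exists (block_mx 0 1%:M 1%:M 0).
  by rewrite mulmx_block !(mul0mx, mulmx0, mul1mx, addr0, add0r)
             -scalar_mx_block.
by rewrite !mulmx_block !(mul0mx, mulmx0, mul1mx, mulmx1, addr0, add0r).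
Qed.

Lemma rsim_castmx n m (e : n = m) (r : mx_representation F G n)
    (s : mx_representation F G m) :
  (forall x, s x = castmx (e, e) (r x)) -> mx_rsim r s.
Proof.
case: m / e s => s rs; exists 1%:M => //; first by rewrite row_free_unit unitmx1.
by move=> x Gx; rewrite rs castmx_id mulmx1 mul1mx.
Qed.

Lemma dadd_rsimA (r s t : grepr) :
  mx_rsim (dadd_grepr r (dadd_grepr s t)) (dadd_grepr (dadd_grepr r s) t).
Proof.
apply/mx_rsim_sym/(@rsim_castmx _ _ (esym (addnA _ _ _))) => x /=.
by have := @block_mxA F _ _ _ _ _ _ (r x) 0 0 0 (s x) 0 0 0 (t x);
   rewrite !(row_mx0, col_mx0).
Qed.

Lemma dadd_rsim0 (r : grepr) : mx_rsim (dadd_grepr grepr0 r) r.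
Proof.
apply/(@rsim_castmx _ _ (add0n _)) => x /=; apply/matrixP=> i j.
rewrite castmxE /= block_mxEv.
have -> : cast_ord (esym (add0n _)) i = rshift 0 i by apply: val_inj.
have -> : cast_ord (esym (add0n _)) j = rshift 0 j by apply: val_inj.
by rewrite col_mxEd row_mxEr.
Qed.

Definition iso_add (c d : iso_class) : iso_class :=
  iso_class_of (dadd_grepr (repr c) (repr d)).

Lemma iso_addE r s :
  iso_add (iso_class_of r) (iso_class_of s) = iso_class_of (dadd_grepr r s).
Proof.
by apply/iso_class_ofE; apply: dadd_rsim; apply/iso_class_ofE;
   rewrite iso_class_repr.
Qed.

Fact iso_addA : associative iso_add.
Proof.
move=> c d e.
rewrite -(iso_class_repr c) -(iso_class_repr d) -(iso_class_repr e).
by rewrite !iso_addE; apply/iso_class_ofE/dadd_rsimA.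
Qed.

Fact iso_addC : commutative iso_add.
Proof. by move=> c d; apply/iso_class_ofE/dadd_rsimC. Qed.

Fact iso_add0 : left_id (iso_class_of grepr0) iso_add.
Proof.
move=> c; rewrite -(iso_class_repr c) iso_addE.
exact/iso_class_ofE/dadd_rsim0.
Qed.

HB.instance Definition _ :=
  GRing.isNmodule.Build iso_class iso_addA iso_addC iso_add0.

(* The additive group of the representation ring R(G)_Z. *)
Definition virtual_rep : zmodType := symmetrization iso_class.

Definition virtual_of (r : grepr) : virtual_rep :=
  sym_pair (iso_class_of r) 0.

(* Class functions on G, with pointwise operations; via characters this is the
   complexified representation ring when F is the field of complex numbers. *)
Definition class_fun_pred : {pred {ffun subg_of G -> F}} :=
  fun f => [forall x, forall y, f (x ^ y)%g == f x].

Fact class_fun_subring : subring_closed class_fun_pred.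
Proof.
split=> [|f g|f g]; rewrite ?unfold_in.
- by apply/forallP=> x; apply/forallP=> y; rewrite !ffunE.
- move=> /'forall_'forall_eqP Hf /'forall_'forall_eqP Hg.
  by apply/'forall_'forall_eqP=> x y; rewrite !ffunE Hf Hg.
move=> /'forall_'forall_eqP Hf /'forall_'forall_eqP Hg.
by apply/'forall_'forall_eqP=> x y; rewrite !ffunE Hf Hg.
Qed.

HB.instance Definition _ :=
  GRing.isSubringClosed.Build {ffun subg_of G -> F} class_fun_pred
    class_fun_subring.

Record class_fun := ClassFun {
  class_fun_val :> {ffun subg_of G -> F};
  _ : class_fun_val \in class_fun_pred }.

HB.instance Definition _ := [isSub for class_fun_val].
HB.instance Definition _ := [Choice of class_fun by <:].
HB.instance Definition _ :=
  GRing.SubChoice_isSubPzRing.Build {ffun subg_of G -> F} class_fun_pred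
    class_fun class_fun_subring.

Fact char_class_fun (r : grepr) :
  [ffun x : subg_of G => \tr (r (sgval x))] \in class_fun_pred.
Proof.
apply/'forall_'forall_eqP=> x y; rewrite !ffunE conjgE.
have [Gx Gy] := (valP x, valP y).
rewrite /= !repr_mxM ?groupM ?groupV // mxtrace_mulC -mulmxA -repr_mxM ?groupV //.
by rewrite mulgV repr_mx1 mulmx1.
Qed.

Definition char_of (r : grepr) : class_fun := ClassFun (char_class_fun r).

End VirtualRepresentations.

(* Exterior powers of 'rV[F]_n.  A basis of the k-th one is indexed by the
   strictly increasing maps f : 'I_k -> 'I_n, f standing for
   e_(f 0) /\ ... /\ e_(f (k - 1)); wedge A is the product of the k rows of A,
   and wedge_universal is its universal property. *)
Section ExteriorPower.

Variables (F : fieldType) (k n : nat).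

Definition incr_ffun : {set {ffun 'I_k -> 'I_n}} :=
  [set f : {ffun 'I_k -> 'I_n} |
    [forall i : 'I_k, forall j : 'I_k, (i < j)%N ==> (f i < f j)%N]].

Definition incr_val (b : 'I_#|incr_ffun|) : {ffun 'I_k -> 'I_n} := enum_val b.

Definition wedge (A : 'M[F]_(k, n)) : 'rV[F]_#|incr_ffun| :=
  \row_b \det (colsub (incr_val b) A).

(* The endomorphism of the exterior power induced by v |-> v *m A. *)
Definition ext_mx (A : 'M[F]_n) : 'M[F]_#|incr_ffun| :=
  \matrix_(a < #|incr_ffun|) wedge (rowsub (incr_val a) A).

Lemma incr_ffunP (f : {ffun 'I_k -> 'I_n}) :
  reflect {homo f : i j / (i < j)%N} (f \in incr_ffun).
Proof.
rewrite inE; apply: (iffP forallP) => [H i j ij|H i].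
  by have /forallP/(_ j)/implyP := H i; apply.
by apply/forallP=> j; apply/implyP; apply: H.
Qed.

Lemma incr_ffun_inj (f : {ffun 'I_k -> 'I_n}) : f \in incr_ffun -> injective f.
Proof.
move=> /incr_ffunP H i j fij; apply/val_inj/eqP.
by case: ltngtP => // /H; rewrite fij ltnn.
Qed.

Lemma incr_ffun_sort (f : 'I_k -> 'I_n) : injective f ->
  exists s : 'S_k, exists2 g, g \in incr_ffun & forall i, f i = g (s i).
Proof.
move=> injf; pose le := relpre (@nat_of_ord n) leq.
pose t := [tuple f i | i < k]; pose u := sort_tuple le t.
have /tuple_permP[s ts] : perm_eq t u by rewrite perm_sym perm_sort.
exists s; exists (finfun (tnth u)); last first.
  move=> i; rewrite ffunE; have tE : t = [tuple tnth u (s i) | i < k].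
    by apply: val_inj.
  by have /(congr1 (fun w => tnth w i)) := tE; rewrite !tnth_mktuple.
apply/incr_ffunP=> i j ij; rewrite !ffunE ltn_neqAle.
have uu : uniq u by rewrite sort_uniq; apply/tuple_uniqP => a b;
  rewrite !tnth_mktuple; apply: injf.
apply/andP; split.
  rewrite (inj_eq val_inj); apply: contraTneq ij.
  by move/tuple_uniqP: uu => /[apply] ->; rewrite ltnn.
have le_tr : transitive le by move=> ? ? ?; apply: leq_trans.
have su : sorted le u by apply: sort_sorted => ? ?; apply: leq_total.
have := sorted_leq_nth le_tr (fun=> leqnn _) (f i) su.
move=> /(_ i j); rewrite !inE !size_tuple !ltn_ord => /(_ isT isT (ltnW ij)).
by rewrite !(tnth_nth (f i)).
Qed.

Lemma incr_ffun_image (f g : {ffun 'I_k -> 'I_n}) :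
    f \in incr_ffun -> g \in incr_ffun ->
  (forall i, exists j, f i = g j) -> f = g.
Proof.
move=> Hf Hg fg; pose lt := relpre (@nat_of_ord n) ltn.
have srt (h : {ffun 'I_k -> 'I_n}) : h \in incr_ffun -> sorted lt (codom h).
  move=> /incr_ffunP Hh; rewrite codomE sorted_map.
  have /sub_sorted : subrel (relpre (@nat_of_ord k) ltn) (relpre h lt).
    by move=> i j; apply: Hh.
  by apply; rewrite -[sorted _ _]sorted_map val_enum_ord iota_ltn_sorted.
have lt_tr : transitive lt by move=> ? ? ?; apply: ltn_trans.
have lt_irr : irreflexive lt by move=> ?; apply: ltnn.
have uc h : h \in incr_ffun -> uniq (codom h).
  by move=> /srt; apply: sorted_uniq.
have sub : {subset codom f <= codom g}.
  by move=> _ /codomP[i ->]; have [j ->] := fg i; apply: codom_f.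
have [|_ eqm] := uniq_min_size (uc f Hf) sub; first by rewrite !size_codom.
have := irr_sorted_eq lt_tr lt_irr (srt f Hf) (srt g Hg) eqm.
rewrite !codomE => /eq_in_map e.
by apply/ffunP=> i; apply: e; rewrite mem_enum.
Qed.

Section Alternating.

Variable V : lmodType F.

Definition mx_multilinear (phi : 'M[F]_(k, n) -> V) :=
  forall A B C i a, row i A = a *: row i B + row i C ->
    row' i B = row' i A -> row' i C = row' i A -> phi A = a *: phi B + phi C.

Definition mx_alternating (phi : 'M[F]_(k, n) -> V) :=
  forall A i j, i != j -> row i A = row j A -> phi A = 0.

End Alternating.

Lemma wedge_multilinear : mx_multilinear wedge.
Proof.
move=> A B C i a Ai BA CA; apply/rowP=> b; rewrite !mxE -[X in _ + X]mul1r.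
apply: (determinant_multilinear (i0 := i)).
- apply/rowP=> j; have /rowP/(_ (incr_val b j)) := Ai.
  by rewrite !mxE mul1r.
- apply/matrixP=> l j; have /matrixP/(_ l (incr_val b j)) := BA.
  by rewrite !mxE.
- apply/matrixP=> l j; have /matrixP/(_ l (incr_val b j)) := CA.
  by rewrite !mxE.
Qed.

Lemma wedge_alternating : mx_alternating wedge.
Proof.
move=> A i j ij Aij; apply/rowP=> b; rewrite !mxE.
apply: (determinant_alternate ij) => l.
by have /rowP/(_ (incr_val b l)) := Aij; rewrite !mxE.
Qed.


Section Universal.

Variables (V : lmodType F) (phi : 'M[F]_(k, n) -> V).
Hypotheses (phi_lin : mx_multilinear phi) (phi_alt : mx_alternating phi).

Local Notation emx f := (rowsub f (1%:M : 'M[F]_n)).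

Let set_row (A : 'M[F]_(k, n)) i (u : 'rV_n) : 'M[F]_(k, n) :=
  \matrix_(l, j) if l == i then u 0 j else A l j.

Let row_set_row A i u : row i (set_row A i u) = u.
Proof. by apply/rowP=> j; rewrite !mxE eqxx. Qed.

Let row'_set_row A i u : row' i (set_row A i u) = row' i A.
Proof. by apply/matrixP=> l j; rewrite !mxE eq_sym (negPf (neq_lift _ _)). Qed.

Let row_set_rowN A i l u : l != i -> row l (set_row A i u) = row l A.
Proof. by move=> li; apply/rowP=> j; rewrite !mxE (negPf li). Qed.

Let set_row_row A i : set_row A i (row i A) = A.
Proof. by apply/matrixP=> l j; rewrite !mxE; case: eqP => // ->. Qed.

Let phi_set_row A i a u v :
  phi (set_row A i (a *: u + v)) = a *: phi (set_row A i u) + phi (set_row A i v).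
Proof. by apply: (phi_lin (i := i)); rewrite ?row_set_row ?row'_set_row. Qed.

Let phi_set_row0 A i : phi (set_row A i 0) = 0.
Proof.
have := phi_set_row A i 1 0 0; rewrite scaler0 addr0 scale1r => /eqP.
by rewrite -subr_eq subrr eq_sym => /eqP.
Qed.

Let phi_row_sum A i :
  phi A = \sum_j A i j *: phi (set_row A i (delta_mx 0 j)).
Proof.
rewrite -{1}(set_row_row A i) (row_sum_delta (row i A)).
transitivity (\sum_j row i A 0 j *: phi (set_row A i (delta_mx 0 j))).
  elim/big_rec2: _ => [|j x u _ <-]; first exact: phi_set_row0.
  exact: phi_set_row.
by apply: eq_bigr => j _; rewrite mxE.
Qed.

Lemma multilinear_eq0 : (forall f : 'I_k -> 'I_n, phi (emx f) = 0) ->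
  forall A, phi A = 0.
Proof.
move=> phi0 A.
suff H m : (m <= k)%N -> forall A,
    (forall i : 'I_k, (m <= i)%N -> exists j, row i A = delta_mx 0 j) ->
  phi A = 0.
  by apply: (H k) => // i; rewrite leqNgt ltn_ord.
elim: m => {A} [_ A HA|m IH mk A HA].
  have [f Hf] : exists f : 'I_k -> 'I_n, forall i, row i A = delta_mx 0 (f i).
    apply: (@fin_all_exists _ (fun=> 'I_n) (fun i j => row i A = delta_mx 0 j)).
    by move=> i; apply: HA.
  suff -> : A = emx f by [].
  apply/row_matrixP=> i; rewrite Hf; apply/rowP=> j.
  by rewrite !mxE eqxx eq_sym.
rewrite (phi_row_sum A (Ordinal mk)) big1 // => j _; rewrite IH ?scaler0 //.
  exact: ltnW.
move=> i mi; have [->|ne] := eqVneq i (Ordinal mk).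
  by exists j; rewrite row_set_row.
rewrite row_set_rowN //; apply: HA; rewrite ltn_neqAle mi andbT.
by apply: contraNneq ne => e; apply/eqP/val_inj.
Qed.

Lemma alternating_tperm A i j : i != j -> phi (xrow i j A) = - phi A.
Proof.
move=> ij; have ji : j != i by rewrite eq_sym.
pose B u v := set_row (set_row A i u) j v.
have rBi u v : row i (B u v) = u by rewrite row_set_rowN // row_set_row.
have rBj u v : row j (B u v) = v by rewrite row_set_row.
have Bj u v w : phi (B u (v + w)) = phi (B u v) + phi (B u w).
  by rewrite -{1}[v]scale1r phi_set_row scale1r.
have BC u v : B u v = set_row (set_row A j v) i u.
  apply/matrixP=> l h; rewrite !mxE; case: (eqVneq l j) => [->|//].
  by rewrite (negPf ji).
have Bi u v w : phi (B (u + v) w) = phi (B u w) + phi (B v w).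
  by rewrite !BC -{1}[u]scale1r phi_set_row scale1r.
have Bd u : phi (B u u) = 0 by apply: (phi_alt ij); rewrite rBi rBj.
have -> : xrow i j A = B (row j A) (row i A).
  apply/matrixP=> l h; rewrite !mxE.
  by case: tpermP => [->|->|/eqP/negPf-> /eqP/negPf->] //;
     rewrite !eqxx ?(negPf ij).
have {3}-> : A = B (row i A) (row j A).
  by apply/matrixP=> l h; rewrite !mxE; case: eqP => [->|] //; case: eqP => [->|].
apply/eqP; rewrite -addr_eq0; have := Bd (row i A + row j A).
by rewrite Bj !Bi !Bd add0r addr0 => ->.
Qed.

Lemma alternating_perm_eq0 (s : 'S_k) A : phi A = 0 -> phi (row_perm s A) = 0.
Proof.
have [ts -> tsP] := prod_tpermP s; elim: ts tsP A => [|t ts IH] /=.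
  by move=> _ A; rewrite big_nil row_perm1.
move=> /andP[t12 tsP] A A0; rewrite big_cons row_permM.
by have := alternating_tperm (row_perm (\prod_(t <- ts) tperm t.1 t.2)%g A) t12;
   rewrite /xrow IH // oppr0.
Qed.

Lemma alternating_eq0 :
    (forall f : {ffun 'I_k -> 'I_n}, f \in incr_ffun -> phi (emx f) = 0) ->
  forall A, phi A = 0.
Proof.
move=> phi0; apply: multilinear_eq0 => f.
have [injf|ninj] := boolP (injectiveb f); last first.
  have /injectivePn[i [j ij fij]] := ninj; apply: (phi_alt ij).
  by rewrite !row_rowsub fij.
have [s [g Hg fE]] := incr_ffun_sort (injectiveP _ injf).
have -> : emx f = row_perm s (emx g).
  by apply/matrixP=> i j; rewrite !mxE fE.
exact/alternating_perm_eq0/phi0.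
Qed.

End Universal.

Lemma wedge_incr (f : {ffun 'I_k -> 'I_n}) b : f \in incr_ffun ->
  wedge (rowsub f 1%:M) 0 b = (f == incr_val b)%:R.
Proof.
move=> Hf; have Hb : incr_val b \in incr_ffun by apply: enum_valP.
rewrite mxE; case: eqP => [<-|ne].
  rewrite -[RHS](det1 F k); congr (\det _); apply/matrixP=> i j.
  by rewrite !mxE (inj_eq (incr_ffun_inj Hf)).
have [/forallP H|/forallPn[i Hi]] :=
  boolP [forall i : 'I_k, exists j : 'I_k, f i == incr_val b j].
  by case: ne; apply: incr_ffun_image => // i; have /existsP[j /eqP] := H i; exists j.
rewrite (expand_det_row _ i) big1 // => j _; rewrite !mxE.
by move/existsPn/(_ j)/negPf: Hi => ->; rewrite mul0r.
Qed.

Lemma wedge_universal (V : lmodType F) (phi : 'M[F]_(k, n) -> V) :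
    mx_multilinear phi -> mx_alternating phi ->
  forall A, phi A =
    \sum_b wedge A 0 b *: phi (rowsub (incr_val b) (1%:M : 'M[F]_n)).
Proof.
move=> lin alt A; apply/eqP; rewrite -subr_eq0; apply/eqP.
move: A; apply: alternating_eq0.
- move=> A B C i a Ai BA CA.
  rewrite (lin _ _ _ _ _ Ai BA CA) (wedge_multilinear Ai BA CA).
  rewrite scalerBr scaler_sumr addrACA -opprD -big_split; congr (_ - _).
  by apply: eq_bigr => b _; rewrite !mxE scalerDl scalerA.
- move=> A i j ij Aij; rewrite (alt _ _ _ ij Aij) (wedge_alternating ij Aij).
  by rewrite big1 ?subrr // => b _; rewrite mxE scale0r.
move=> f Hf; rewrite (bigD1 (enum_rank_in Hf f)) //= big1 => [|b nb].
  by rewrite wedge_incr // /incr_val enum_rankK_in // eqxx scale1r addr0 subrr.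
rewrite wedge_incr // [f == _](introF eqP) ?scale0r // => fb.
by case/eqP: nb; apply: enum_val_inj; rewrite enum_rankK_in.
Qed.

Lemma wedge_mul (A : 'M[F]_(k, n)) B : wedge (A *m B) = wedge A *m ext_mx B.
Proof.
rewrite (wedge_universal (phi := fun A => wedge (A *m B))).
- rewrite [RHS]mulmx_sum_row; apply: eq_bigr => b _.
  by rewrite rowK mul_rowsub_mx mul1mx.
- move=> C D E i a Ci DC EC; apply: (wedge_multilinear (i := i)).
  + by rewrite !row_mul Ci mulmxDl scalemxAl.
  + by rewrite !row'Esub -!mul_rowsub_mx -!row'Esub DC.
  + by rewrite !row'Esub -!mul_rowsub_mx -!row'Esub EC.
- move=> C i j ij Cij; apply: (wedge_alternating ij).
  by rewrite !row_mul Cij.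
Qed.

Lemma ext_mxM A B : ext_mx (A *m B) = ext_mx A *m ext_mx B.
Proof.
by apply/row_matrixP=> a; rewrite row_mul !rowK -mul_rowsub_mx wedge_mul.
Qed.

Lemma ext_mx1 : ext_mx 1%:M = 1%:M.
Proof.
apply/matrixP=> a b; rewrite mxE wedge_incr ?mxE; last exact: enum_valP.
by rewrite (inj_eq enum_val_inj).
Qed.

End ExteriorPower.

Section ExteriorRepresentation.

Variables (F : fieldType) (gT : finGroupType) (G : {group gT}).

Lemma ext_mx_repr k (r : representation F G) :
  mx_repr G (fun x => ext_mx k (r x)).
Proof.
by split=> [|x y Gx Gy]; rewrite ?repr_mx1 ?ext_mx1 // repr_mxM // ext_mxM.
Qed.

Definition ext_power_repr k (r : representation F G) : representation F G :=
  Representation (MxRepresentation (ext_mx_repr k r)).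

(* The k-th exterior power of an n-dimensional space is 0 for k > n. *)
Definition wedge_repr (r : representation F G) : representation F G :=
  \big[dadd_grepr/grepr0]_(k < (rdegree r).+1) ext_power_repr k r.

End ExteriorRepresentation.

(* Main.v *)
(** The character of [wedge rho] at [x] is the sum of all principal minors of
    [rho x], that is [\det (1 + rho x)].  This is multiplicative in [rho], so
    [wedge] extends to virtual representations exactly when it never vanishes,
    that is, when no [rho x] has eigenvalue [-1].  If [A ^+ m = 1] with [m] odd,
    then [1 + A] divides [1 + A ^+ m = 2].  If [x] is an involution, then
    [(1 + A) (1 - A) = 0] for the image [A != 1] of [x] in the regular
    representation, so [1 + A] is singular. *)

Require Import Defs.
From mathcomp Require Import all_boot all_order all_algebra all_fingroup.
From mathcomp Require Import mxrepresentation character.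
From mathcomp Require Import reals complex.
From mathcomp Require Import generic_quotient cyclic pgroup.

Set Implicit Arguments.
Unset Strict Implicit.
Unset Printing Implicit Defensive.

Import GroupScope GRing.Theory Num.Theory.
Local Open Scope ring_scope.

(** * Principal minors and the expansion of [\det (1 + A)] *)

Section PrincipalMinors.

(** Rows and columns undergo the same permutation, so the two signs cancel. The sizes are linked by
    an equation because [m] will be a sum [k + #|~: J|], not convertible to [n]. *)
Lemma det_mxsub_inj (S : comPzRingType) (m n : nat) (h : 'I_m -> 'I_n)
    (M : 'M[S]_n) : m = n -> injective h -> \det (mxsub h h M) = \det M.
Proof.
move=> e; case: n / e h M => h M injh.
have -> : mxsub h h M = row_perm (perm injh) (col_perm (perm injh) M).
  by apply/matrixP=> i j; rewrite !mxE !permE.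
rewrite row_permE col_permE !det_mulmx !det_perm mulrCA -signr_addb odd_permV.
by rewrite addbb mulr1.
Qed.

(** Once the indices in [J] are listed first, the matrix is block upper triangular, and the rows
    outside [J] contribute an identity block. *)
Lemma det_row_select (S : comNzRingType) (n k : nat) (A : 'M[S]_n)
    (f : 'I_k -> 'I_n) (J : {set 'I_n}) :
  injective f -> J = [set f i | i : 'I_k] ->
  \det (\matrix_(i, j) if i \in J then A i j else (i == j)%:R) =
  \det (mxsub f f A).
Proof.
move=> injf defJ; set M := \matrix_(_, _) _.
pose g (i : 'I_#|~: J|) : 'I_n := enum_val i.
have gJ i : (g i \in J) = false.
  by apply/negbTE; have := enum_valP i; rewrite inE.
have fJ i : f i \in J by rewrite defJ imset_f.
pose h (i : 'I_(k + #|~: J|)) :=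
  match split i with inl a => f a | inr b => g b end.
have hl i : h (lshift _ i) = f i by rewrite /h (unsplitK (inl i)).
have hr i : h (rshift _ i) = g i by rewrite /h (unsplitK (inr i)).
have injh : injective h.
  move=> u v; rewrite -[u]splitK -[v]splitK.
  case: (split u) => a; case: (split v) => b /=; rewrite ?hl ?hr.
  - by move/injf=> ->.
  - by move=> e; have := gJ b; rewrite -e fJ.
  - by move=> e; have := gJ a; rewrite e fJ.
  - by move/enum_val_inj=> ->.
have en : (k + #|~: J| = n)%N.
  by rewrite -{1}[k]card_ord -(card_imset _ injf) -defJ cardsC card_ord.
rewrite -(det_mxsub_inj _ en injh) -[mxsub h h M]submxK.
have -> : ulsubmx (mxsub h h M) = mxsub f f A.
  by apply/matrixP=> i j; rewrite !mxE !hl fJ.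
have -> : dlsubmx (mxsub h h M) = 0.
  apply/matrixP=> i j; rewrite !mxE hl hr gJ.
  by case: eqP => // e; have := gJ i; rewrite e fJ.
have -> : drsubmx (mxsub h h M) = 1%:M.
  by apply/matrixP=> i j; rewrite !mxE !hr gJ (inj_eq enum_val_inj).
by rewrite det_ublock det1 mulr1.
Qed.

(** In the Leibniz formula, each product of binomials is expanded over the set [J] of rows in which
    the term of [A] is chosen. *)
Lemma det_add1mx (S : comNzRingType) (n : nat) (A : 'M[S]_n) :
  \det (1%:M + A) =
  \sum_(J : {set 'I_n})
     \det (\matrix_(i, j) if i \in J then A i j else (i == j)%:R).
Proof.
rewrite exchange_big /=; apply: eq_bigr => s _.
rewrite -mulr_sumr; congr (_ * _).
transitivity (\prod_i (A i (s i) + (i == s i)%:R)).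
  by apply: eq_bigr => i _; rewrite !mxE addrC.
rewrite bigA_distr; apply: eq_bigr => J _.
by apply: eq_bigr => i _; rewrite !mxE.
Qed.

Lemma incr_ffun_imset_inj (k n : nat) :
  {in incr_ffun k n &,
    injective (fun f : {ffun 'I_k -> 'I_n} => [set f i | i : 'I_k])}.
Proof.
move=> f g Hf Hg e; apply: incr_ffun_image => // i.
have : f i \in [set g j | j : 'I_k] by rewrite -e imset_f.
by case/imsetP=> j _ ->; exists j.
Qed.

(** Sorting an enumeration of [J] yields an increasing map with image [J]. With injectivity, basis
    vectors of the [k]-th exterior power match the subsets of size [k]. *)
Lemma incr_ffun_imset (k n : nat) :
  [set [set f i | i : 'I_k] | f : {ffun 'I_k -> 'I_n} in incr_ffun k n] =
  [set J : {set 'I_n} | #|J| == k].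
Proof.
apply/setP=> J; rewrite inE; apply/imsetP/eqP => [[f Hf ->]|eJ].
  by rewrite card_imset ?card_ord //; apply: incr_ffun_inj.
case: k / eJ.
have [s [g Hg e]] := incr_ffun_sort (@enum_val_inj _ (mem J)).
exists g => //; apply/setP=> x; apply/idP/imsetP => [Jx|[i _ ->]].
  by exists (s (enum_rank_in Jx x)); rewrite // -e enum_rankK_in.
by rewrite -(permKV s i) -e enum_valP.
Qed.

(** The diagonal entries of [ext_mx k A] are the principal minors of size [k]; the subsets in
    [det_add1mx] are grouped by cardinality. *)
Lemma sum_mxtrace_ext (F : fieldType) (n : nat) (A : 'M[F]_n) :
  \sum_(k < n.+1) \tr (ext_mx k A) = \det (1%:M + A).
Proof.
(* [inord] never falls back to its default value here, since [#|J| <= n]. *)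
pose card_ord_of (J : {set 'I_n}) : 'I_n.+1 := inord #|J|.
rewrite det_add1mx (partition_big card_ord_of predT) //=.
apply: eq_bigr => k _.
transitivity (\sum_(f in incr_ffun k n) \det (mxsub f f A)).
  rewrite big_enum_val; apply: eq_bigr => a _.
  by rewrite !mxE; congr (\det _); apply/matrixP=> i j; rewrite !mxE.
transitivity (\sum_(J in [set J : {set 'I_n} | #|J| == k])
    \det (\matrix_(i, j) if i \in J then A i j else (i == j)%:R)).
  rewrite -incr_ffun_imset big_imset /=; last exact: incr_ffun_imset_inj.
  apply: eq_bigr => f Hf; apply/esym/det_row_select => //.
  exact: incr_ffun_inj Hf.
apply: eq_bigl => J; rewrite inE -val_eqE /= inordK //.
by rewrite ltnS -[n in (_ <= n)%N]card_ord max_card.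
Qed.

End PrincipalMinors.

(** * The character of the exterior algebra *)

Section WedgeCharacter.

Variables (F : fieldType) (gT : finGroupType) (G : {group gT}).
Implicit Types r s : representation F G.

Lemma class_funP (f g : class_fun F G) : (forall x, f x = g x) -> f = g.
Proof. by move=> fg; apply/val_inj/ffunP=> x; apply: fg. Qed.

Lemma class_funM (f g : class_fun F G) x : (f * g) x = f x * g x.
Proof. by rewrite -[LHS]/(val (f * g) x) rmorphM ffunE. Qed.

Lemma class_fun1 x : (1 : class_fun F G) x = 1.
Proof. by rewrite -[LHS]/(val (1 : class_fun F G) x) rmorph1 ffunE. Qed.

Lemma char_of_wedge r (x : subg_of G) :
  char_of (wedge_repr r) x = \det (1%:M + r (sgval x)).
Proof.
rewrite ffunE -sum_mxtrace_ext /wedge_repr.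
elim/big_rec2: _ => [|k t s _ <-] /=; first by rewrite /mxtrace big_ord0.
exact: mxtrace_block.
Qed.

(** An intertwiner [B] satisfies [(1 + r x) B = B (1 + s x)]; taking determinants, the nonzero
    [\det B] cancels. *)
Lemma char_of_wedge_rsim r s : mx_rsim r s ->
  char_of (wedge_repr r) = char_of (wedge_repr s).
Proof.
move=> rs; apply: class_funP => x; rewrite !char_of_wedge.
case: rs => B; case: r B => n r; case: s => m s /= B e.
case: m / e s B => s B; rewrite row_free_unit => Bu hB.
have detB : \det B != 0 by rewrite -unitfE -unitmxE.
apply: (mulIf detB); rewrite [RHS]mulrC -!det_mulmx mulmxDl mulmxDr.
by rewrite mul1mx mulmx1 hB ?subgP.
Qed.

Lemma char_of_wedge_dadd r s :
  char_of (wedge_repr (dadd_grepr r s)) =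
  char_of (wedge_repr r) * char_of (wedge_repr s).
Proof.
apply: class_funP => x; rewrite class_funM !char_of_wedge /=.
by rewrite (@scalar_mx_block F) add_block_mx !addr0 det_ublock.
Qed.

Lemma char_of_wedge0 : char_of (wedge_repr (@grepr0 F gT G)) = 1.
Proof.
apply: class_funP => x; rewrite class_fun1 char_of_wedge.
by rewrite det_mx00.
Qed.

(** * Extension to isomorphism classes, then to virtual representations *)

Definition iso_wedge (c : iso_class F G) : class_fun F G :=
  char_of (wedge_repr (repr c)).

Lemma iso_wedgeE r : iso_wedge (iso_class_of r) = char_of (wedge_repr r).
Proof. by apply/char_of_wedge_rsim/iso_class_ofE/iso_class_repr. Qed.

Lemma iso_wedge0 : iso_wedge 0 = 1.
Proof. by rewrite iso_wedgeE char_of_wedge0. Qed.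

Lemma iso_wedgeD c d : iso_wedge (c + d) = iso_wedge c * iso_wedge d.
Proof. by rewrite iso_wedgeE char_of_wedge_dadd. Qed.

Lemma class_fun_div (f g : class_fun F G) :
  [ffun x => f x / g x] \in @class_fun_pred F gT G.
Proof.
have /'forall_'forall_eqP Hf := valP f; have /'forall_'forall_eqP Hg := valP g.
by apply/'forall_'forall_eqP=> x y; rewrite !ffunE /= Hf Hg.
Qed.

(** The value is computed on a chosen pair, with inversion sending 0 to 0; independence of the pair
    is obtained below under [wedge_neq0]. *)
Definition virtual_wedge (u : virtual_rep F G) : class_fun F G :=
  ClassFun (class_fun_div (iso_wedge (repr u).1) (iso_wedge (repr u).2)).

Hypothesis wedge_neq0 : forall r x, char_of (wedge_repr r) x != 0.

(** Equivalent pairs agree up to a common summand [e], whose factor cancels because it is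
    nonzero. *)
Lemma virtual_wedgeE a b x :
  virtual_wedge (sym_pair a b) x = iso_wedge a x / iso_wedge b x.
Proof.
rewrite ffunE.
have /sym_pairE[e ee] := sym_pair_repr (sym_pair a b).
move/(congr1 (fun c => iso_wedge c x)): ee.
rewrite !iso_wedgeD !class_funM => /(mulIf (wedge_neq0 _ _)) ee.
by apply/eqP; rewrite eqr_div ?wedge_neq0 // ee.
Qed.

Lemma virtual_wedge0 : virtual_wedge 0 = 1.
Proof.
apply: class_funP => x; rewrite virtual_wedgeE divff ?class_fun1 //.
exact: wedge_neq0.
Qed.

Lemma virtual_wedgeD u v :
  virtual_wedge (u + v) = virtual_wedge u * virtual_wedge v.
Proof.
rewrite -(sym_pair_repr u) -(sym_pair_repr v).
apply: class_funP => x; rewrite class_funM.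
have -> : forall a b c d : iso_class F G,
  sym_pair a b + sym_pair c d = sym_pair (a + c) (b + d) by exact: sym_addE.
by rewrite !virtual_wedgeE !iso_wedgeD !class_funM mulf_div.
Qed.

Lemma virtual_wedge_of r :
  virtual_wedge (virtual_of r) = char_of (wedge_repr r).
Proof.
apply: class_funP => x.
by rewrite virtual_wedgeE iso_wedge0 iso_wedgeE class_fun1 divr1.
Qed.

End WedgeCharacter.

(** * Eigenvalue -1 and the parity of the order *)

Lemma repr_mxX (S : comUnitRingType) (gT : finGroupType) (G : {group gT})
    (n : nat) (r : mx_representation S G n) (x : gT) (m : nat) :
  x \in G -> r (x ^+ m)%g = r x ^+ m.
Proof.
move=> Gx; elim: m => [|m IHm]; first by rewrite expg0 expr0 repr_mx1.
by rewrite expgS exprS repr_mxM ?groupX // IHm.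
Qed.

Lemma wedge_neq0_odd (F : fieldType) (gT : finGroupType) (G : {group gT})
    (r : representation F G) (x : subg_of G) :
  2%:R != 0 :> F -> odd #|G| -> char_of (wedge_repr r) x != 0.
Proof.
move=> F2 oddG; rewrite char_of_wedge; set A := r _.
have Ax : A ^+ #|G| = 1.
  by rewrite -repr_mxX ?subgP // expg_cardG ?subgP // repr_mx1.
(* The factor [-A - 1] is split off [(- A) ^+ m - 1] for [m = #|G|], which equals -2 because [m] is
   odd and [A ^+ m = 1]. *)
have /esym e2 := subrX1 (- A) #|G|.
rewrite exprNn -signr_odd oddG Ax expr1 mulr1 -!opprD mulNr in e2.
move/oppr_inj: e2; rewrite addrC => /(congr1 determinant).
rewrite [(1 + A) * _]/GRing.mul /= det_mulmx => e2.
have : \det (1 + 1 : 'M[F]_(rdegree r)) != 0.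
  have -> : 1 + 1 = 2%:R%:M :> 'M[F]_(rdegree r).
    by rewrite (natrD _ 1 1) raddfD.
  by rewrite det_scalar expf_neq0.
by rewrite -e2 mulf_eq0 negb_or => /andP[].
Qed.

Lemma wedge_regular_eq0 (F : fieldType) (gT : finGroupType) (G : {group gT})
    (x : subg_of G) : #[sgval x] = 2%N ->
  char_of (wedge_repr (Representation (regular_repr F G))) x = 0.
Proof.
move=> ox; rewrite char_of_wedge /=; set A := regular_mx _ _ _.
have Gx := subgP x.
have A2 : A *m A = 1%:M.
  rewrite -[A]/(regular_repr F G _) -repr_mxM // -(repr_mx1 (regular_repr F G)).
  congr (regular_repr F G _).
  by have := expg_order (sgval x); rewrite ox expgS expg1.
apply/eqP; rewrite -[_ == _]negbK -unitfE -unitmxE; apply/negP=> uA.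
have : (1%:M + A) *m (1%:M - A) = 0.
  by rewrite mulmxDl !mulmxBr !mul1mx mulmx1 A2 addrC addrA subrK subrr.
move/(congr1 (mulmx (invmx (1%:M + A)))); rewrite mulKmx // mulmx0 => /eqP.
rewrite subr_eq0 => /eqP A1.
(* Cancelling the supposed unit [1 + A] gave [A = 1], which contradicts the faithfulness of the
   regular representation. *)
have : sgval x \in rker (regular_repr F G).
  by rewrite inE Gx mul1mx -[X in X == _]/A -A1 eqxx.
move/(subsetP (regular_mx_faithful F G)) => /set1P x1.
by rewrite x1 order1 in ox.
Qed.

Theorem proposition2p1 (R : realType) (gT : finGroupType) (G : {group gT}) :
  odd #|G| <->
  exists W : virtual_rep R[i] G -> class_fun R[i] G,
    [/\ W 0 = 1,
        forall x y : virtual_rep R[i] G, W (x + y) = W x * W y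
      & forall rho : representation R[i] G,
          W (virtual_of rho) = char_of (wedge_repr rho)].
Proof.
split=> [oddG|[W [W0 WD Wr]]].
  have nz r (x : subg_of G) : char_of (wedge_repr r) x != 0 :> R[i].
    by apply: wedge_neq0_odd; rewrite ?pnatr_eq0.
  exists (@virtual_wedge _ _ _); split.
  - exact: virtual_wedge0.
  - exact: virtual_wedgeD.
  - exact: virtual_wedge_of.
apply: contraT; rewrite -dvdn2 => /(Cauchy (isT : prime 2))[x Gx ox].
pose y : subg_of G := Subg Gx.
(* The class of the regular representation plus its opposite is 0, so the two values of [W] multiply
   to 1; at the involution [y] the first of them is 0. *)
have := WD (virtual_of (Representation (regular_repr R[i] G)))
  (- virtual_of (Representation (regular_repr R[i] G))).
rewrite subrr W0 Wr => /(congr1 (fun f : class_fun R[i] G => f y)).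
rewrite class_funM class_fun1 wedge_regular_eq0 // mul0r => /eqP.
by rewrite oner_eq0.
Qed.
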